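(* Let $G=(S,A_1,A_2,\to,\mathit{Goal})$ be a GLTS and $St$ a stable reduction. A state $s\in S$ is winning for player $1$ in $G$ if and only if $s$ is winning for player $1$ in the reduced game $G_{St}$.
   Context: A GLTS is a tuple $G=(S,A_1,A_2,\to,\mathit{Goal})$ with $S$ a set of states, $A_1$ (player 1) and $A_2$ (player 2) finite disjoint action sets, $A=A_1\cup A_2$, $\to\subseteq S\times A\times S$ deterministic (if $(s,a,s'),(s,a,s'')\in\to$ then $s'=s''$), and $\mathit{Goal}\subseteq S$ the goal states. Write $s\xrightarrow{a}s'$ for $(s,a,s')\in\to$, and for $w=a_1\cdots a_n$, $s\xrightarrow{w}s'$ for a chain of such steps. $en_i(s)=\{a\in A_i\mid\exists s'.\,s\xrightarrow{a}s'\}$, $en(s)=en_1(s)\cup en_2(s)$. A run from $s$ is a finite or infinite state sequence $\pi_0\pi_1\cdots$ with $\pi_0=s$ and consecutive states connected by transitions; it is maximal if infinite or its last state $s'$ has $en(s')=\emptyset$. A strategy is $\sigma:S\to A_1\cup\{\bot\}$ with $\sigma(s)\in en_1(s)$ if $en_1(s)\neq\emptyset$, else $\sigma(s)=\bot$. $\mathit{Next}_\sigma(s)=en_2(s)\cup\{\sigma(s)\}$ if $\sigma(s)\ne\bot$, else $en_2(s)$. $\sigma$ is winning at $s$ if every maximal run from $s$ in which each step from $\pi_{i-1}$ uses an action of $\mathit{Next}_\sigma(\pi_{i-1})$ visits a state of $\mathit{Goal}$; $s$ is winning (for player 1) if a winning strategy at $s$ exists. A reduction is a function $St:S\to 2^A$,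 with $\overline{St(s)}=A\setminus St(s)$. The reduced game $G_{St}=(S,A_1,A_2,\to_{St},\mathit{Goal})$ has $s\xrightarrow{a}_{St}s'$ iff $s\xrightarrow{a}s'$ and $a\in St(s)$ (enabled sets, strategies, runs and winning are taken w.r.t. $\to_{St}$ there). For each $s$ fix an interesting set $I(s,\mathit{Goal})\subseteq A$: whenever $s\notin\mathit{Goal}$, $s\xrightarrow{a_1\cdots a_n}s'\in\mathit{Goal}$, some $a_i\in I(s,\mathit{Goal})$. For $s$ with $en_2(s)=\emptyset$, an action $a\in en_1(s)$ is safe in $s$ if whenever $w\in(A_1\setminus\{a\})^*$ with $s\xrightarrow{w}s'$, $en_2(s')=\emptyset$ and $s\xrightarrow{aw}s''$, then $en_2(s'')=\emptyset$; $\mathit{safe}(s)$ is the set of safe actions in $s$. $St$ is stable if for every $s\in S$: (I) if $en_1(s)\ne\emptyset$ and $en_2(s)\ne\emptyset$ then $en(s)\subseteq St(s)$; (W) for all $w\in\overline{St(s)}^*$ and $a\in St(s)$, if $s\xrightarrow{wa}s'$ then $s\xrightarrow{aw}s'$; (R) $I(s,\mathit{Goal})\subseteq St(s)$; (G1) for all $w\in\overline{St(s)}^*$, if $en_2(s)=\emptyset$ and $s\xrightarrow{w}s'$ then $en_2(s')=\emptyset$; (G2) for all $w\in\overline{St(s)}^*$, if $en_1(s)=\emptyset$ and $s\xrightarrow{w}s'$ then $en_1(s')=\emptyset$; (S) $en_1(s)\cap St(s)\subseteq\mathit{safe}(s)$ or $en_1(s)\subseteq St(s)$; (V) if there is $w\in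 A_2^*$ with $s\xrightarrow{w}s'$ and $s'\in\mathit{Goal}$ then $en_2(s)\subseteq St(s)$; (D) if $en_2(s)\ne\emptyset$ then there is $a\in en_2(s)\cap St(s)$ such that for all $w\in\overline{St(s)}^*$ with $s\xrightarrow{w}s'$ we have $a\in en_2(s')$. *)

(* Defs.v *)
From mathcomp Require Import all_boot.
From mathcomp Require Import classical_sets.

Set Implicit Arguments.
Unset Strict Implicit.
Unset Printing Implicit Defensive.

Local Open Scope classical_set_scope.

(* The action set A is the whole finite type [A]; [A1] and [A2] partition it. *)
Record glts (S : Type) (A : finType) := GLTS {
  A1 : set A;
  A2 : set A;
  A12_disjoint : A1 `&` A2 = set0;
  A12_cover : A1 `|` A2 = setT;
  trans : S -> A -> S -> Prop;
  trans_det : forall s a s' s'', trans s a s' -> trans s a s'' -> s' = s'';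
  Goal : set S
}.

Section Game.
Variables (S : Type) (A : finType) (G : glts S A).

Fixpoint steps (s : S) (w : seq A) (s' : S) : Prop :=
  if w is a :: w' then exists2 t, trans G s a t & steps t w' s' else s = s'.

Definition en1 (s : S) : set A := [set a | A1 G a /\ exists s', trans G s a s'].
Definition en2 (s : S) : set A := [set a | A2 G a /\ exists s', trans G s a s'].
Definition en (s : S) : set A := en1 s `|` en2 s.

(* The run pi_0 ... pi_n is encoded with [run_last = Some n], an infinite run
   with [run_last = None]; the values of [run_state] beyond [n] are irrelevant. *)
Record run := Run { run_last : option nat; run_state :> nat -> S }.

Definition in_run (pi : run) (i : nat) : bool :=
  if run_last pi is Some n then i <= n else true.

Definition run_from (s : S) (pi : run) : Prop :=
  pi 0 = s /\
  forall i, in_run pi i.+1 -> exists a, trans G (pi i) a (pi i.+1).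

Definition maximal (pi : run) : Prop :=
  if run_last pi is Some n then en (pi n) = set0 else True.

(* [None] stands for the bottom value of a strategy. *)
Definition strategy (sigma : S -> option A) : Prop :=
  forall s, (en1 s !=set0 -> exists2 a, sigma s = Some a & en1 s a) /\
            (en1 s = set0 -> sigma s = None).

Definition Next (sigma : S -> option A) (s : S) : set A :=
  if sigma s is Some a then en2 s `|` [set a] else en2 s.

Definition subject_to (sigma : S -> option A) (pi : run) : Prop :=
  forall i, in_run pi i.+1 ->
    exists2 a, Next sigma (pi i) a & trans G (pi i) a (pi i.+1).

Definition winning_strategy (s : S) (sigma : S -> option A) : Prop :=
  strategy sigma /\
  forall pi, run_from s pi -> maximal pi -> subject_to sigma pi ->
    exists2 i, in_run pi i & Goal G (pi i).

Definition winning (s : S) : Prop := exists sigma, winning_strategy s sigma.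

Definition star (B : set A) : set (seq A) := [set w | forall a, a \in w -> B a].

Definition interesting (I : S -> set A) : Prop :=
  forall s w s', ~ Goal G s -> steps s w s' -> Goal G s' ->
    exists2 a, a \in w & I s a.

(* Empty when [en2 s] is nonempty, where safety is not defined. This choice has
   no effect on condition (S) below, which then follows from condition (I). *)
Definition safe (s : S) : set A :=
  [set a | [/\ en2 s = set0, en1 s a &
    forall w s' s'', star (A1 G `\ a) w -> steps s w s' -> en2 s' = set0 ->
      steps s (a :: w) s'' -> en2 s'' = set0]].

Record stable (I St : S -> set A) : Prop := Stable {
  stable_I : forall s, en1 s !=set0 -> en2 s !=set0 -> en s `<=` St s;
  stable_W : forall s w a s', star (~` St s) w -> St s a ->
    steps s (rcons w a) s' -> steps s (a :: w) s';
  stable_R : forall s, I s `<=` St s;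
  stable_G1 : forall s w s', star (~` St s) w ->
    en2 s = set0 -> steps s w s' -> en2 s' = set0;
  stable_G2 : forall s w s', star (~` St s) w ->
    en1 s = set0 -> steps s w s' -> en1 s' = set0;
  stable_S : forall s, en1 s `&` St s `<=` safe s \/ en1 s `<=` St s;
  stable_V : forall s,
    (exists w s', [/\ star (A2 G) w, steps s w s' & Goal G s']) ->
    en2 s `<=` St s;
  stable_D : forall s, en2 s !=set0 ->
    exists2 a, (en2 s `&` St s) a &
      forall w s', star (~` St s) w -> steps s w s' -> en2 s' a
}.

End Game.

Section Reduction.
Variables (S : Type) (A : finType) (G : glts S A) (St : S -> set A).

Definition reduced_trans (s : S) (a : A) (s' : S) : Prop :=
  trans G s a s' /\ St s a.

Lemma reduced_trans_det s a s' s'' :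
  reduced_trans s a s' -> reduced_trans s a s'' -> s' = s''.
Proof. by move=> [h1 _] [h2 _]; apply: trans_det h1 h2. Qed.

Definition reduced : glts S A :=
  GLTS (A12_disjoint G) (A12_cover G) reduced_trans_det (Goal G).

End Reduction.

(* Main.v *)
(* Since there are finitely many actions, a state is winning exactly when it has
   a finite attractor rank, and both implications go by induction on this rank.
   From [G] to the reduced game, the only delicate states are those where player 2
   is disabled: (R) and (G1) force a stable action on the winning path, (W) moves
   the first one to the front, and (S) keeps player 2 disabled along the permuted
   path, so that the rank decreases. From the reduced game to [G], the only
   delicate states are those where player 1 is disabled: if player 2 cannot reach
   the goal alone, a run that postpones stable actions is permuted by (W) to one
   that starts with a stable action, and the rank of its successor bounds the
   delay, since (D) keeps a stable action enabled. *)

Require Import Defs.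
From mathcomp Require Import all_boot.
From mathcomp Require Import boolp classical_sets.

Set Implicit Arguments.
Unset Strict Implicit.
Unset Printing Implicit Defensive.

Local Open Scope classical_set_scope.

(** * Attractor ranks and their equivalence with winning *)

Section Attractor.
Variables (S : Type) (A : finType) (G : glts S A).

(** Cumulative rank: player 1 forces the goal within [n] steps. The first clause excludes deadlocks;
    where both players are enabled either may move, so the other two are conjoined. *)
Fixpoint attr (n : nat) (s : S) : Prop :=
  if n is m.+1 then
    attr m s \/
    [/\ en G s !=set0,
        forall a t, A2 G a -> trans G s a t -> attr m t &
        en1 G s !=set0 -> exists a t, [/\ A1 G a, trans G s a t & attr m t]]
  else Goal G s.

Definition attracted (s : S) : Prop := exists n, attr n s.

Lemma attr_leq m n s : m <= n -> attr m s -> attr n s.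
Proof.
move=> /subnK <-; elim: (n - m) => [//|k IH] h.
by left; apply: IH.
Qed.

Lemma A1_or_A2 a : A1 G a \/ A2 G a.
Proof.
have : (A1 G `|` A2 G) a by rewrite A12_cover.
by [].
Qed.

Lemma en_trans s a t : trans G s a t -> en G s !=set0.
Proof.
by move=> st; exists a; case: (A1_or_A2 a) => ha; [left|right]; split => //; exists t.
Qed.

(** By determinism a state has at most one successor per action, so the ranks of its successors have
    a finite maximum. *)
Lemma attracted_step s : en G s !=set0 ->
  (forall a t, A2 G a -> trans G s a t -> attracted t) ->
  (en1 G s !=set0 -> exists a t, [/\ A1 G a, trans G s a t & attracted t]) ->
  attracted s.
Proof.
move=> ens h2 h1.
have /choice[f hf] : forall a, exists n, forall t, A2 G a -> trans G s a t -> attr n t.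
  move=> a; case: (pselect (A2 G a /\ exists t, trans G s a t)) => [[ha [t st]]|no].
    have [n hn] := h2 _ _ ha st.
    by exists n => t' _ st'; rewrite -(trans_det st st').
  by exists 0 => t ha st; case: no; split => //; exists t.
have [k hk] : exists k, en1 G s !=set0 ->
    exists a t, [/\ A1 G a, trans G s a t & attr k t].
  case: (pselect (en1 G s !=set0)) => [/h1[a [t [ha st [k hk]]]]|no]; last by exists 0.
  by exists k => _; exists a, t.
exists (maxn k (\max_a f a)).+1; right; split => //.
- move=> a t ha st; apply: attr_leq (hf _ _ ha st).
  by rewrite leq_max (leq_bigmax a) orbT.
- move=> /hk[a [t [ha st ht]]]; exists a, t; split => //.
  by apply: attr_leq ht; rewrite leq_max leqnn.
Qed.

(** Against any strategy, a state without rank that is not a deadlock has a permitted successor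
    without rank; iterating gives a maximal run that avoids the goal. *)
Lemma winning_attracted s : winning G s -> attracted s.
Proof.
move=> [sigma [hstr hwin]]; apply: contrapT => nas.
have /choice[f hf] : forall x, exists y, ~ attracted x -> en G x !=set0 ->
    ~ attracted y /\ exists2 a, Next G sigma x a & trans G x a y.
  move=> x; case: (pselect (~ attracted x /\ en G x !=set0)) => [[nax enx]|no];
    last by exists x => ? ?; case: no.
  apply: contrapT => noy; apply: nax; apply: attracted_step => //.
    move=> a t ha xt; apply: contrapT => nt; apply: noy; exists t => _ _; split => //.
    exists a => //; rewrite /Next.
    have e2 : en2 G x a by split => //; exists t.
    by case: (sigma x) => [b|//]; left.
  move=> en1x; have [a sx [ha [t xt]]] := (hstr x).1 en1x.
  exists a, t; split => //; apply: contrapT => nt; apply: noy; exists t => _ _.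
  by split => //; exists a => //; rewrite /Next sx; right.
pose p i := iter i f s.
have key n : (forall i, i < n -> en G (p i) !=set0) -> ~ attracted (p n).
  elim: n => [//|n IH] h.
  have nap : ~ attracted (p n) by apply: IH => i /ltnW/h.
  by have [] := hf _ nap (h n (leqnn _)).
suff [l [hmax hl]] : exists l, maximal G (Run l p) /\
    forall i, in_run (Run l p) i.+1 -> forall j, j <= i -> en G (p j) !=set0.
  have hna i : in_run (Run l p) i -> ~ attracted (p i).
    by case: i => [//|i] /hl h; apply: key => j; apply: h.
  have hstep i : in_run (Run l p) i.+1 ->
      exists2 a, Next G sigma (p i) a & trans G (p i) a (p i.+1).
    move=> hi; have h := hl _ hi.
    have nap : ~ attracted (p i) by apply: key => j /ltnW/h.
    by have [] := hf _ nap (h i (leqnn _)).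
  have [|i hi gi] := hwin (Run l p) _ hmax hstep.
    by split => // i /hstep[a _ ?]; exists a.
  by apply: (hna i hi); exists 0.
(* The run stops at the first deadlock of [p], if there is one, and is infinite otherwise. *)
case: (pselect (exists n, `[< en G (p n) = set0 >])) => [ex|no]; last first.
  exists None; split => // i _ j _; apply: contrapT => h; apply: no; exists j.
  by apply/asboolP; apply: contrapT => /eqP/set0P.
case: (ex_minnP ex) => m /asboolP hm hmin; exists (Some m); split => // i.
rewrite /in_run /= => im j ji; apply/set0P/eqP => e.
by move: (hmin j (asboolT e)); rewrite leqNgt (leq_ltn_trans ji im).
Qed.

Lemma attracted_winning s : attracted s -> winning G s.
Proof.
have /choice[sigma hs] : forall x, exists o : option A,
    (en1 G x !=set0 -> exists2 a, o = Some a & en1 G x a /\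
       forall n, attr n.+1 x -> ~ attr n x -> exists2 t, trans G x a t & attr n t) /\
    (en1 G x = set0 -> o = None).
  move=> x; case: (pselect (en1 G x !=set0)) => [en1x|no]; last first.
    by exists None; split.
  suff [a ha] : exists a, en1 G x a /\ forall n, attr n.+1 x -> ~ attr n x ->
      exists2 t, trans G x a t & attr n t.
    exists (Some a); split; first by move=> _; exists a.
    by move=> e; move: en1x; rewrite e => -[].
  (* As ranks are cumulative, at most one [n] qualifies, so one memoryless choice serves all [n]. *)
  case: (pselect (exists n, attr n.+1 x /\ ~ attr n x)) => [[n [hn hn']]|no].
    case: hn => [//|[_ _ /(_ en1x)[a [t [ha xt ht]]]]].
    exists a; split; first by split => //; exists t.
    move=> m hm hm'; exists t => //; apply: attr_leq ht.
    rewrite leqNgt; apply/negP => mn; apply: hn'.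
    exact: attr_leq hm.
  by have [a ha] := en1x; exists a; split => // n hn hn'; case: no; exists n.
move=> [n hn]; exists sigma; split.
  by move=> x; split; [move=> /(hs x).1[a ? []]; exists a|apply: (hs x).2].
move=> pi [pi0 _] hmax hsub.
suff H : forall n i, in_run pi i -> attr n (pi i) ->
    exists2 i, in_run pi i & Goal G (pi i).
  by apply: (H n 0); [rewrite /in_run; case: (run_last pi)|rewrite pi0].
elim=> [|{}m IH] i ri hi; first by exists i.
case: (pselect (attr m (pi i))) => [/IH|nh]; first exact.
have hi' := hi; case: hi' => [//|[eni h2 h1]].
(* A maximal run cannot end here, since the rank clause makes some action enabled. *)
case ri1 : (in_run pi i.+1); last first.
  move: hmax ri ri1; rewrite /maximal /in_run; case: (run_last pi) => [l|//] el il /negbT.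
  rewrite -ltnNge ltnS => li; have e : i = l by apply/eqP; rewrite eqn_leq il.
  by move: eni; rewrite e el => -[].
apply: (IH i.+1) => //.
have [a hna ta] := hsub _ ri1.
move: hna; rewrite /Next; case E : (sigma (pi i)) => [b|]; last by case=> ha _; apply: h2 ta.
case=> [[ha _]|/= eab]; first exact: h2 ta.
case: (pselect (en1 G (pi i) !=set0)) => [e1|e1]; last first.
  by rewrite (hs (pi i)).2 in E => //; apply: contrapT => /eqP/set0P.
have [c ec [_ /(_ m hi nh)[t tt ht]]] := (hs (pi i)).1 e1.
move: ec; rewrite E => -[ebc]; move: tt; rewrite -ebc -eab => tt.
by rewrite (trans_det ta tt).
Qed.

Lemma winningP s : winning G s <-> attracted s.
Proof. by split; [apply: winning_attracted|apply: attracted_winning]. Qed.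

(** * Ranks along finite paths *)

Lemma steps_cat s w1 w2 t : steps G s (w1 ++ w2) t <->
  exists2 u, steps G s w1 u & steps G u w2 t.
Proof.
elim: w1 s => [|a w1 IH] s /=.
  by split=> [h|[u -> //]]; exists s.
split=> [[x sx /IH[u h1 h2]]|[u [x sx h1] h2]].
  by exists u => //; exists x.
by exists x => //; apply/IH; exists u.
Qed.

Lemma steps_rcons s w a t : steps G s (rcons w a) t <->
  exists2 u, steps G s w u & trans G u a t.
Proof.
rewrite -cats1; split=> [/steps_cat[u su [x ux <-]]|[u su ut]].
  by exists u.
by apply/steps_cat; exists u => //; exists t.
Qed.

(** Away from the goal each action of player 2 lowers the rank by one, and rank 0 is the goal
    itself. *)
Lemma attr_steps2 n s w t : attr n s ->
  (forall v u, star (A2 G) v -> steps G s v u -> ~ Goal G u) ->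
  star (A2 G) w -> steps G s w t ->
  size w <= n /\ attr (n - size w) t.
Proof.
elim: n s w => [|n IH] s w hs ng hw st.
  by case: (ng [::] s).
case: (hs) => [hs'|[_ h2 _]].
  have [le ht] := IH _ _ hs' ng hw st.
  by split; [apply: leqW|apply: attr_leq ht; apply: leq_sub2r].
case: w hw st => [|a w] hw.
  by move=> /= <-; split => //; rewrite subn0.
move=> [x sx xt]; have ha : A2 G a by apply: hw; rewrite mem_head.
rewrite /= ltnS subSS; apply: (IH x) => //; first exact: h2 sx.
  move=> v u hv xu; apply: (ng (a :: v)); last by exists x.
  by move=> c; rewrite inE => /orP[/eqP-> //|/hv].
by move=> c cw; apply: hw; rewrite inE cw orbT.
Qed.

(** Player 1 plays [w] without interference, at a cost of one rank per action. *)
Lemma attr_steps1 n s w t : attr n t -> star (A1 G) w -> steps G s w t ->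
  (forall w1 b w2 u, w = w1 ++ b :: w2 -> steps G s w1 u -> en2 G u = set0) ->
  attr (n + size w) s.
Proof.
move=> ht; elim: w s => [|a w IH] s hw; first by move=> /= ->; rewrite addn0.
move=> [x sx xt] hpre; rewrite addnS; right; split.
- exact: en_trans sx.
- move=> b y hb sy; have e : en2 G s b by split => //; exists y.
  by move: e; rewrite (hpre [::] a w s).
- move=> _; exists a, x; split => //; first by apply: hw; rewrite mem_head.
  apply: IH => // [b bw|w1 b w2 u ew xu]; first by apply: hw; rewrite inE bw orbT.
  by apply: (hpre (a :: w1) b w2) => /=; [rewrite ew|exists x].
Qed.

(* Follow a winning strategy until the first action of [B], stopping early at a
   goal state or where player 2 may interfere. *)
Lemma attr_path (B : set A) n s : attr n s -> exists w t m,
  [/\ star (A1 G `\` B) w, steps G s w t, m + size w <= n,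
      forall w1 b w2 u, w = w1 ++ b :: w2 -> steps G s w1 u -> en2 G u = set0 &
      [\/ Goal G t, en2 G t !=set0 |
          exists a u k, [/\ A1 G a, B a, trans G t a u, attr k u & k < m]]].
Proof.
elim: n s => [|n IH] s hs.
  by exists [::], s, 0; split => //; [case|constructor 1].
case: hs => [/IH[w [t [m [? ? le ? ?]]]]|[ens h2 h1]].
  by exists w, t, m; split => //; apply: leqW.
case: (pselect (en2 G s !=set0)) => [e2|/set0P/negP/negPn/eqP e2].
  by exists [::], s, 0; split => //; [case|constructor 2].
have e1 : en1 G s !=set0 by case: ens => a [|]; [exists a|rewrite e2].
have [a [t [ha st ht]]] := h1 e1.
case: (pselect (B a)) => [Ba|nBa].
  (* Here [m] is the rank left at the end of the path; the action in [B] spends at least one of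
     it. *)
  exists [::], s, n.+1; split => //=; [by rewrite addn0|by case|constructor 3].
  by exists a, t, n.
have [w [y [m [hw ty le hpre hend]]]] := IH _ ht.
exists (a :: w), y, m; split => //=.
- by move=> b; rewrite inE => /orP[/eqP-> //|/hw].
- by exists t.
- by rewrite addnS ltnS.
- case=> [|c w1] b w2 u /= [eac ew]; first by move=> <-.
  rewrite -eac => -[x sx xu]; apply: (hpre _ _ _ _ ew).
  by rewrite (trans_det st sx).
Qed.

End Attractor.

(** * From the game to the reduced game *)

Section Stable.
Variables (S : Type) (A : finType) (G : glts S A) (I St : S -> set A).
Hypotheses (hI : interesting G I) (hSt : stable G I St).

(* The first stable action on a winning path of player 1 can be moved to the
   front; safety keeps player 2 disabled along the permuted path. *)
Lemma attr_stable_move n s : ~ Goal G s -> en2 G s = set0 -> attr G n.+1 s ->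
  exists a t, [/\ A1 G a, St s a, trans G s a t & attr G n t].
Proof.
move=> ngs e2 hs.
have [w [y [m [hw sy le hpre hend]]]] := attr_path (St s) hs.
have hw' : star (~` St s) w by move=> b /hw[].
case: hend => [gy|e2y|[a [z [k [ha Sa yz hz km]]]]].
- have [b bw Ib] := hI ngs sy gy.
  by case: (hw' _ bw); apply: (stable_R hSt Ib).
- by case: e2y => b; rewrite (stable_G1 hSt hw' e2 sy).
have /(stable_W hSt hw' Sa)[x sx xz] : steps G s (rcons w a) z.
  by apply/steps_rcons; exists y.
exists a, x; split => //.
have le' : k + size w <= n by rewrite -ltnS (leq_trans _ le) // ltn_add2r.
apply: attr_leq le' _; apply: attr_steps1 hz _ xz _; first by move=> b /hw[].
move=> w1 b w2 u ew xu.
case: (stable_S hSt s) => [hsafe|hall].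
  have [_ _ hsaf] : safe G s a by apply: hsafe; split => //; split => //; exists x.
  have := sy; rewrite ew => /steps_cat[u' su' _].
  apply: (hsaf w1 u' u) => //.
  - move=> c cw; have [|? nc] := hw c; first by rewrite ew mem_cat cw.
    by split => // ec; apply: nc; rewrite ec.
  - exact: hpre ew su'.
  - by exists x.
(* If all enabled actions of player 1 are stable, [w] must be empty: its first action would be
   enabled and unstable. *)
case: w hw hw' sy ew {le hpre} => [|c w] hw hw'; first by case: (w1).
move=> [v sv _] _; have cw : c \in c :: w by rewrite mem_head.
by case: (hw' _ cw); apply: hall; split; [case: (hw _ cw)|exists v].
Qed.

Lemma attr_reduced n s : attr G n s -> attracted (reduced G St) s.
Proof.
elim: n s => [|n IH] s hs; first by exists 0.
case: (pselect (Goal G s)) => [gs|ngs]; first by exists 0.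
case: (pselect (en2 G s !=set0)) => [e2|/set0P/negP/negPn/eqP e2].
  (* Removing moves of player 2 does no harm: (D) prevents a deadlock, and (I) keeps the answer of
     player 1 if there is one. *)
  case: (hs) => [/IH //|[ens h2 h1]].
  apply: attracted_step.
  - have [a [[ha [t st]] Sa] _] := stable_D hSt e2.
    exact: (@en_trans _ _ (reduced G St) s a t).
  - by move=> a t ha [st Sa]; apply: IH; apply: h2 st.
  - move=> [b [hb [u [su _]]]].
    have e1 : en1 G s !=set0 by exists b; split => //; exists u.
    have [a [t [ha st ht]]] := h1 e1; exists a, t; split => //; last exact: IH.
    by split => //; apply: (stable_I hSt e1 e2); left; split => //; exists t.
have [a [t [ha Sa st ht]]] := attr_stable_move ngs e2 hs.
apply: attracted_step.
- exact: (@en_trans _ _ (reduced G St) s a t).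
- move=> b u hb [su _]; have e : en2 G s b by split => //; exists u.
  by move: e; rewrite e2.
- by move=> _; exists a, t; split => //; apply: IH.
Qed.

(** * From the reduced game back to the game *)

Lemma star2_unstable s w t : en1 G s = set0 -> star (~` St s) w ->
  steps G s w t -> star (A2 G) w.
Proof.
move=> e1 hw st b bw; case/splitPr: bw hw st => w1 w2 hw /steps_cat[u su [v uv _]].
case: (A1_or_A2 G b) => // hb.
have e : en1 G u b by split => //; exists v.
suff e0 : en1 G u = set0 by move: e; rewrite e0.
by apply: (stable_G2 hSt _ e1 su) => c cw; apply: hw; rewrite mem_cat cw.
Qed.

(* A word avoiding [St s] is no longer than the rank of [s']: it commutes with [a],
   and player 2 cannot delay the goal for longer than that rank. *)
Lemma attracted_player2 s a s' :
  en1 G s = set0 -> A2 G a -> St s a -> trans G s a s' ->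
  (forall w t, star (~` St s) w -> steps G s w t -> en2 G t a) ->
  (forall v u, star (A2 G) v -> steps G s v u -> ~ Goal G u) ->
  (forall b t, A2 G b -> St s b -> trans G s b t -> attracted G t) ->
  attracted G s.
Proof.
move=> e1 ha Sa ss' hD ng hSucc.
have ng' b x : A2 G b -> trans G s b x ->
    forall v u, star (A2 G) v -> steps G x v u -> ~ Goal G u.
  move=> hb sx v u hv xu; apply: (ng (b :: v)); last by exists x.
  by move=> c; rewrite inE => /orP[/eqP-> //|/hv].
have [N hN] := hSucc _ _ ha Sa ss'.
(* [k] is the remaining budget of unstable actions; at [k = 0] the word [w] is longer than the rank
   [N] of [s'] allows. *)
suff H k w t : star (~` St s) w -> steps G s w t -> N < k + size w -> attracted G t.
  by apply: (H N.+1 [::]) => //; rewrite addn0.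
elim: k w t => [|k IH] w t hw st lt.
  have [_ [u tu]] := hD _ _ hw st.
  have /(stable_W hSt hw Sa)[x sx xu] : steps G s (rcons w a) u.
    by apply/steps_rcons; exists t.
  have [le _] := attr_steps2 hN (ng' _ _ ha ss') (star2_unstable e1 hw st)
    (eq_ind_r (fun y => steps G y w u) xu (trans_det ss' sx)).
  by move: lt; rewrite add0n ltnNge le.
apply: attracted_step.
- by have [_ [u tu]] := hD _ _ hw st; apply: en_trans tu.
- move=> b u hb tu.
  have su : steps G s (rcons w b) u by apply/steps_rcons; exists t.
  case: (pselect (St s b)) => [Sb|nSb].
    (* With the stable [b] moved to the front, [u] is reached from a ranked successor of [s] by
       player 2 alone. *)
    have [x sx xu] := stable_W hSt hw Sb su.
    have [M hM] := hSucc _ _ hb Sb sx.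
    have [_ hu] := attr_steps2 hM (ng' _ _ hb sx) (star2_unstable e1 hw st) xu.
    by exists (M - size w).
  apply: IH su _; last by rewrite size_rcons addnS.
  by move=> c; rewrite mem_rcons inE => /orP[/eqP-> //|/hw].
- by rewrite (stable_G2 hSt hw e1 st) => -[].
Qed.

Lemma attr_of_reduced n s : attr (reduced G St) n s -> attracted G s.
Proof.
elim: n s => [|n IH] s hs; first by exists 0.
case: hs => [/IH //|[ens h2 h1]].
have hSucc a t : A2 G a -> St s a -> trans G s a t -> attracted G t.
  by move=> ha Sa st; apply: IH; apply: (h2 a).
have ensG : en G s !=set0.
  by case: ens => a [] [_ [t [st _]]]; apply: en_trans st.
case: (pselect (en1 G s !=set0)) => [e1|/set0P/negP/negPn/eqP e1].
  apply: attracted_step => //.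
    move=> a t ha st; apply: hSucc (ha) _ (st).
    have e2 : en2 G s a by split => //; exists t.
    by apply: (stable_I hSt e1); [exists a|right].
  move=> _; suff /h1[a [t [ha [st _] ht]]] : en1 (reduced G St) s !=set0.
    by exists a, t; split => //; apply: IH.
  (* If only a move of player 2 is known to survive, both players are enabled in [G] and (I) keeps
     every action. *)
  case: ens => a [ea|[ha [t [st _]]]]; first by exists a.
  have [b eb] := e1; have [hb [u su]] := eb.
  exists b; split => //; exists u; split => //.
  by apply: (stable_I hSt e1); [exists a; split => //; exists t|left].
have e2 : en2 G s !=set0 by case: ensG => a [|]; [rewrite e1|exists a].
(* If player 2 can reach the goal alone, (V) makes all its actions stable, so every successor is
   ranked already. *)
case: (pselect (exists w s', [/\ star (A2 G) w, steps G s w s' & Goal G s'])) => [hV|nV].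
  apply: attracted_step => //; last by rewrite e1 => -[].
  move=> a t ha st; apply: hSucc (ha) _ (st).
  by apply: (stable_V hSt hV); split => //; exists t.
have [a [[ha [t st]] Sa] hD] := stable_D hSt e2.
apply: (attracted_player2 e1 ha Sa st hD) => // v u hv su gu.
by apply: nV; exists v, u.
Qed.

End Stable.

Theorem theorem3p6 (S : Type) (A : finType) (G : glts S A)
    (I St : S -> set A) (hI : interesting G I) (hSt : stable G I St) (s : S) :
  winning G s <-> winning (reduced G St) s.
Proof.
rewrite !winningP; split=> -[n].
  exact: (attr_reduced hI hSt).
exact: (attr_of_reduced hSt).
Qed.
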